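(* For every integer $n\ge 1$ there is a split permutation graph with $4n^3$ vertices that contains every split permutation graph with $n$ vertices as an induced subgraph.
   Context: All graphs are finite, simple, undirected. A graph is split if its vertex set can be partitioned into a clique and an independent set. The permutation graph of a permutation $\pi$ of $[m]$ has vertex set $[m]$, with $i<j$ adjacent iff $j$ appears before $i$ in the one-line notation of $\pi$; a permutation graph is any graph isomorphic to such a graph. A split permutation graph is a graph that is both a split graph and a permutation graph. *)

(* Defs.v *)
From mathcomp Require Import all_boot all_fingroup.

Set Implicit Arguments.
Unset Strict Implicit.
Unset Printing Implicit Defensive.

Record sgraph := SGraph {
  vertex :> finType;
  adj : rel vertex;
  adj_sym : symmetric adj;
  adj_irr : irreflexive adj
}.

Definition iso (G H : sgraph) : Prop :=
  exists2 f : G -> H, bijective f & forall x y, adj (f x) (f y) = adj x y.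

Section Induced.
Variables (G : sgraph) (S : {set G}).

Definition induced_adj : rel {x : G | x \in S} :=
  fun x y => adj (val x) (val y).

Lemma induced_adj_sym : symmetric induced_adj.
Proof. by move=> x y; apply: adj_sym. Qed.

Lemma induced_adj_irr : irreflexive induced_adj.
Proof. by move=> x; apply: adj_irr. Qed.

Definition induced : sgraph := SGraph induced_adj_sym induced_adj_irr.
End Induced.

Definition contains_induced (G H : sgraph) : Prop :=
  exists S : {set G}, iso H (induced S).

Definition clique (G : sgraph) (K : {set G}) : Prop :=
  {in K &, forall x y, x != y -> adj x y}.

Definition independent (G : sgraph) (I : {set G}) : Prop :=
  {in I &, forall x y, ~~ adj x y}.

(* Either part may be empty. *)
Definition split_graph (G : sgraph) : Prop :=
  exists K : {set G}, clique K /\ independent (~: K).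

Section PermGraph.
Variables (m : nat) (s : 'S_m).

(* The one-line notation of s is s 0, s 1, ..., s (m - 1) (values and positions
   shifted to start at 0), so the value j occurs at position s^-1 j. *)
Definition appears_before (j i : 'I_m) : bool := (s^-1%g j < s^-1%g i)%N.

Definition perm_adj : rel 'I_m := fun i j =>
  (i < j) && appears_before j i || (j < i) && appears_before i j.

Lemma perm_adj_sym : symmetric perm_adj.
Proof. by move=> i j; apply: orbC. Qed.

Lemma perm_adj_irr : irreflexive perm_adj.
Proof. by move=> i; rewrite /perm_adj ltnn. Qed.

Definition perm_graph : sgraph := SGraph perm_adj_sym perm_adj_irr.
End PermGraph.

Definition permutation_graph (G : sgraph) : Prop :=
  exists (m : nat) (s : 'S_m), iso G (perm_graph s).

Definition split_permutation_graph (G : sgraph) : Prop :=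
  split_graph G /\ permutation_graph G.

(* Main.v *)
Require Import Defs.
From mathcomp Require Import all_boot all_fingroup.
From mathcomp Require Import zify.

Set Implicit Arguments.
Unset Strict Implicit.
Unset Printing Implicit Defensive.

(* A split permutation graph is the inversion graph of a planar point set that
   is the union of a decreasing chain K and an increasing chain I. A suitable
   center cuts the chains into four arms, and two points on neighbouring arms
   are compared by their distance to the center along the axis they share.
   Along the path K left - I left - K right - I right these comparisons are
   consistent, so all n points get positions t in one linear order; the
   comparisons across the upper side, between the last arm and the first, may
   contradict it. The positions split into blocks in which all contradictions
   have the same orientation, and in each block the upper comparisons amount to
   a semiorder, so it is represented by a spiral: a turn number r and an
   offset p such that passing from the last arm to the first shifts r by 1.
   The universal graph has four arms indexed by all triples (b, r, p) below n,
   with the direction of the shift given by the parity of the block name b. *)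

(** * Linear extensions and minimal elements *)

Lemma linear_extension (T : finType) (R : rel T) :
  (forall S : {set T}, S != set0 ->
     exists2 v, v \in S & forall u, u \in S -> ~~ R u v) ->
  exists t : T -> nat,
    [/\ injective t, forall v, t v < #|T| & forall u v, R u v -> t u < t v].
Proof.
move=> minR.
suff ext m (S : {set T}) : #|S| = m -> exists t : T -> nat,
    [/\ {in S &, injective t}, {in S, forall v, t v < m} &
        {in S &, forall u v, R u v -> t u < t v}].
  have [t [injt ltt monot]] := ext _ setT (cardsT T).
  exists t; split=> [u v||u v]; [exact: injt | move=> v | exact: monot].
  exact: ltt.
elim: m S => [|m IHm] S cardS.
  by exists (fun=> 0); rewrite (cards0_eq cardS); split=> u; rewrite inE.
have [|v vS minv] := minR S; first by rewrite -card_gt0 cardS.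
have [|t [injt ltt monot]] := IHm (S :\ v).
  by have := cardsD1 v S; rewrite vS cardS => -[].
have inD u : u \in S -> u != v -> u \in S :\ v by rewrite !inE => -> ->.
exists (fun u => if u == v then 0 else (t u).+1); split=> [x y xS yS|x xS|x y xS yS].
- case: eqVneq => [->|xv]; case: eqVneq => [->|yv] // [].
  by apply: injt; apply: inD.
- by case: eqVneq => // xv; apply: ltt; apply: inD.
- case: (eqVneq y v) => [->|yv]; first by rewrite (negPf (minv x xS)).
  by case: eqVneq => // xv Rxy; apply: monot => //; apply: inD.
Qed.

(* Walking up the levels from a minimal element of the lowest one, each step
   going to a smallest predecessor on the next level, ends at a minimal
   element: only transitivity on pairs of consecutive levels is available. *)
Lemma level_minimal (T : finType) (lev : T -> nat) (R : rel T) :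
  irreflexive R ->
  (forall u v, R u v -> lev u <= (lev v).+1 /\ lev v <= (lev u).+1) ->
  (forall a u v w, a <= lev u <= a.+1 -> a <= lev v <= a.+1 ->
     a <= lev w <= a.+1 -> R u v -> R v w -> R u w) ->
  forall S : {set T}, S != set0 ->
    exists2 v, v \in S & forall u, u \in S -> ~~ R u v.
Proof.
move=> irrR levR trR S S0.
have minl a (A : {set T}) : A != set0 -> {in A, forall u, lev u = a} ->
    exists2 v, v \in A & forall u, u \in A -> ~~ R u v.
  case/set0Pn=> x0 x0A levA; pose c v := #|[set u in A | R u v]|.
  (* Inside one level [R] is a strict order, so an element with fewest predecessors has none. *)
  case: (@arg_minnP _ x0 (mem A) c x0A) => v vA minv; exists v => // u uA.
  apply/negP=> Ruv; have := minv u uA; rewrite leqNgt => /negP; apply.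
  apply: proper_card; apply/properP; split.
    apply/subsetP=> w; rewrite !inE => /andP[wA Rwu]; rewrite wA /=.
    by apply: (trR a _ u) => //; rewrite levA // leqnn leqnSn.
  by exists u; rewrite !inE uA ?irrR.
have [x0 x0S] := set0Pn _ S0.
pose M := \max_(u in S) lev u.
have leM u : u \in S -> lev u <= M by move=> uS; exact: leq_bigmax_cond.
(* Invariant of the walk: [v] has no predecessor on its level or below; [k] bounds the number of
   levels left. *)
suff climb k v : v \in S -> M - lev v <= k ->
    (forall u, u \in S -> lev u <= lev v -> ~~ R u v) ->
    exists2 v, v \in S & forall u, u \in S -> ~~ R u v.
  case: (@arg_minnP _ x0 (mem S) lev x0S) => y yS miny.
  have [||v] := minl (lev y) [set u in S | lev u == lev y].
  - by apply/set0Pn; exists y; rewrite inE eqxx andbT.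
  - by move=> u; rewrite inE => /andP[_ /eqP].
  rewrite inE => /andP[vS /eqP lv] minv.
  apply: (climb _ v vS (leqnn _)) => u uS lu; apply: minv.
  by rewrite inE uS eqn_leq [_ <= lev u]miny // andbT -lv.
elim: k v => [|k IHk] v vS lek minv.
  exists v => // u uS; apply: minv => //; apply: leq_trans (leM u uS) _.
  by rewrite -subn_eq0 -leqn0.
pose A := [set u in S | (lev u == (lev v).+1) && R u v].
have [A0|A0] := eqVneq A set0.
  exists v => // u uS; apply/negP=> Ruv.
  have [lu|lu] := leqP (lev u) (lev v); first by have := minv u uS lu; rewrite Ruv.
  have [lu' _] := levR _ _ Ruv.
  have : u \in A by rewrite inE uS Ruv eqn_leq lu lu'.
  by rewrite A0 inE.
have [|x] := minl (lev v).+1 A A0.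
  by move=> u; rewrite inE => /and3P[_ /eqP].
rewrite inE => /and3P[xS /eqP lx Rxv] minx.
apply: (IHk x xS); first by rewrite lx; lia.
move=> u uS lu; apply/negP=> Rux; have [_ lu'] := levR _ _ Rux.
have Ruv : R u v by apply: (trR (lev v) _ x) => //; lia.
have [luv|luv] := leqP (lev u) (lev v).
  by have := minv u uS luv; rewrite Ruv.
have : u \in A by rewrite inE uS Ruv andbT; lia.
by move/minx; rewrite Rux.
Qed.

(** * Semiorders: turns and offsets *)

(* [link c d] says that [d] is at most one unit beyond [c]. Each turn starts at
   the first point not linked to the start of the previous one, so points of
   the same turn are linked, points two turns apart are not, and only the
   comparison of consecutive turns is left to the offsets. *)
Section Semiorder.
Variable link : rel nat.
Hypothesis link_refl : reflexive link.
Hypothesis link_mono : forall c c' d d', c <= c' -> d' <= d -> link c d -> link c' d'.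

Fixpoint turn_start (c : nat) : nat :=
  if c is c'.+1 then
    if link (turn_start c') c then turn_start c' else c
  else 0.

Fixpoint turn (c : nat) : nat :=
  if c is c'.+1 then
    turn c' + ~~ link (turn_start c') c
  else 0.

Lemma turn_mono c d : c <= d -> turn c <= turn d.
Proof.
elim: d => [|d IHd]; first by rewrite leqn0 => /eqP->.
rewrite leq_eqVlt ltnS => /predU1P[->//|/IHd le] /=.
by apply: leq_trans le (leq_addr _ _).
Qed.

Lemma turn_le c : turn c <= c.
Proof. by elim: c => //= c IHc; case: link => /=; lia. Qed.

Lemma turn_start_le c : turn_start c <= c.
Proof. by elim: c => //= c IHc; case: ifP => // _; apply: leqW. Qed.

Lemma link_turn_start c : link (turn_start c) c.
Proof. by case: c => //= c; case: ifP. Qed.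

Lemma turn_start_eq c d : c <= d -> turn c = turn d -> turn_start c = turn_start d.
Proof.
elim: d => [|d IHd]; first by rewrite leqn0 => /eqP->.
rewrite leq_eqVlt ltnS => /predU1P[->//|le] /=.
have := turn_mono le; case: ifP => /= _ lec; last by lia.
by rewrite addn0 => /(IHd le).
Qed.

Lemma turn_start_gt c d : turn c < turn d -> c < turn_start d.
Proof.
elim: d => //= d IHd; case: ifP => /= [_|nlk lt]; first by rewrite addn0.
by rewrite ltnNge; apply/negP => /turn_mono /=; rewrite nlk; lia.
Qed.

Lemma link_same_turn c d : turn d = turn c -> link c d.
Proof.
move=> eq_r; have [le|/ltnW le] := leqP d c.
  exact: (link_mono le (leqnn d) (link_refl d)).
have eqs : turn_start c = turn_start d by apply: turn_start_eq.
apply: (link_mono _ (leqnn d) (link_turn_start d)).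
by rewrite -eqs turn_start_le.
Qed.

(** The turn before that of [d] starts beyond [c], and its start is not linked to the first position
    of the turn of [d]. *)
Lemma link_far_turn c d : (turn c).+1 < turn d -> ~~ link c d.
Proof.
elim: d => //= d IHd; case: (boolP (link (turn_start d) d.+1)) => /= [_|nlk].
  rewrite addn0 => /IHd; apply: contra; exact: link_mono.
have [lt _|] := ltnP (turn c) (turn d); last by lia.
by apply: contra nlk; apply: link_mono => //; apply/ltnW/turn_start_gt.
Qed.

Lemma semiorder_offset (n : nat) : exists p : nat -> nat,
  [/\ forall c, c < n -> p c < n,
      forall c d, c < n -> d < n -> p c = p d -> c = d,
      forall c d, c < d < n -> turn c = turn d -> p c < p d &
      forall c d, c < n -> d < n -> turn d = (turn c).+1 -> link c d = (p d < p c)].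
Proof.
(* The order that the offsets must respect. It relates equal or consecutive turns only, so turns
   serve as levels. Between consecutive turns, the later point comes first if it is linked and last
   otherwise. *)
pose R (u v : 'I_n) :=
  if turn u == turn v then u < v else
  if turn v == (turn u).+1 then ~~ link u v else (turn u == (turn v).+1) && link v u.
have [|q [injq ltq monoq]] := @linear_extension _ R.
  apply: (@level_minimal _ (fun u : 'I_n => turn u)).
  - by move=> u; rewrite /R eqxx ltnn.
  - by move=> u v; rewrite /R; case: eqP => [->|_] //; case: eqP => [->|_]; lia.
  - move=> a u v w lu lv lw; have L := link_mono.
    have {}lu : turn u = a \/ turn u = a.+1 by lia.
    have {}lv : turn v = a \/ turn v = a.+1 by lia.
    have {}lw : turn w = a \/ turn w = a.+1 by lia.
    have an : (a == a.+1) = false by lia.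
    have an2 : (a == a.+2) = false by lia.
    rewrite /R; case: lu => ->; case: lv => ->; case: lw => ->;
      rewrite ?eqxx ?(eq_sym a.+1) ?an ?an2 ?eqxx /=.
    + exact: ltn_trans.
    + by move=> /ltnW uv; apply/contra/L.
    + by move=> nuv lwv; rewrite ltnNge; apply: contra nuv => wu; apply: L lwv.
    + by move=> nuv /ltnW vw; apply: contra nuv; apply: L.
    + by move=> lvu /ltnW vw; apply: L lvu.
    + by move=> lvu; rewrite ltnNge; apply: contra => wu; apply: L lvu.
    + by move=> /ltnW uv; apply: L.
    + exact: ltn_trans.
pose p c := if insub c is Some u then q (u : 'I_n) else 0.
have pE c (lc : c < n) : p c = q (Ordinal lc) by rewrite /p insubT.
exists p; split=> [c lc|c d lc ld|c d /andP[lcd ld] rcd|c d lc ld rcd].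
- by rewrite pE -[X in _ < X]card_ord.
- by rewrite !pE => /injq [].
- have lc := ltn_trans lcd ld; rewrite !pE; apply: monoq.
  by rewrite /R /= rcd eqxx.
- rewrite !pE; have [lk|nlk] := boolP (link c d).
    apply/esym/monoq; rewrite /R /= rcd eqxx lk.
    by case: eqP => [|_]; [lia|]; case: eqP => [|_]; [lia|].
  apply/esym/negbTE; rewrite -leqNgt; apply/ltnW/monoq.
  by rewrite /R /= rcd eqxx nlk; case: eqP; lia.
Qed.

End Semiorder.

(** * Lexicographic keys *)

Lemma lex_ltl n x y p q : p < n -> x < y -> x * n + p < y * n + q.
Proof.
move=> ltp ltxy; apply: (@leq_trans (x.+1 * n)); first by rewrite mulSn addnC ltn_add2r.
by apply: leq_trans (leq_addr _ _); rewrite leq_mul2r ltxy orbT.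
Qed.

Lemma lex_ltr n x y p q : x <= y -> p < q -> x * n + p < y * n + q.
Proof. by move=> lexy ltpq; rewrite -addnS leq_add // leq_mul2r lexy orbT. Qed.

Definition lex3 (b r p b' r' p' : nat) : bool :=
  [|| b < b', (b == b') && (r < r') | [&& b == b', r == r' & p < p']].

(** * Crossings between two chains *)

Section Crossing.
Variables (V : finType) (t Y : V -> nat).

(** A contradiction between positions and [Y] that spans [c] to [j] and whose earlier point is in
    [A]. *)
Definition crossed (A B : {set V}) (c j : nat) : bool :=
  [exists u in A, [exists v in B, [&& t u <= c, j <= t v & Y v < Y u]]].

Lemma crossedP (A B : {set V}) (c j : nat) :
  reflect (exists u v, [/\ u \in A, v \in B, t u <= c, j <= t v & Y v < Y u])
          (crossed A B c j).
Proof.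
apply: (iffP exists_inP) => [[u uA /exists_inP[v vB /and3P[uc jv Yvu]]]|].
  by exists u, v.
case=> u [v [uA vB uc jv Yvu]]; exists u => //; apply/exists_inP; exists v => //.
exact/and3P.
Qed.

Lemma crossed_mono (A B : {set V}) c c' d d' :
  c <= c' -> d' <= d -> crossed A B c d -> crossed A B c' d'.
Proof.
move=> lec led /crossedP[u [v [uA vB uc dv Yvu]]]; apply/crossedP; exists u, v.
by split=> //; [apply: leq_trans lec | apply: leq_trans dv].
Qed.

Definition order_agree (A : {set V}) : Prop :=
  {in A &, forall u v, (t u <= t v) = (Y u <= Y v)}.

Section TwoChains.
Variables A B : {set V}.
Hypotheses (agreeA : order_agree A) (agreeB : order_agree B).

(** The two crossings would give [Y u <= Y v' < Y u' <= Y v < Y u]. *)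
Lemma crossed_opposite c c' j j' : c' <= j -> c <= j' ->
  crossed A B c j -> ~~ crossed B A c' j'.
Proof.
move=> lec'j lecj' /crossedP[u [v [uA vB uc jv Yvu]]].
apply/negP=> /crossedP[u' [v' [u'B v'A u'c j'v' Yvu']]].
have : t u' <= t v by lia.
have : t u <= t v' by lia.
by rewrite (agreeA uA v'A) (agreeB u'B vB); lia.
Qed.

(** The witnesses [u'], [v'] lie outside the pair, so [Y v <= Y v' < Y u' <= Y u]. *)
Lemma crossed_pair c j u v : crossed A B c j -> t u = c -> t v = j ->
  u \in A -> v \in B -> Y v < Y u.
Proof.
move=> /crossedP[u' [v' [u'A v'B u'c jv' Yvu]]] tu tv uA vB.
have : t u' <= t u by lia.
have : t v <= t v' by lia.
by rewrite (agreeA u'A uA) (agreeB vB v'B); lia.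
Qed.

End TwoChains.
End Crossing.

(** * Blocks of equally oriented crossings *)

Section Blocks.
Variables (V : finType) (t Y : V -> nat) (A B : {set V}).
Hypotheses (agreeA : order_agree t Y A) (agreeB : order_agree t Y B).

(** The [link] of the semiorder: positions [c < j] are linked when a crossing of either orientation
    spans them. *)
Definition linked (c j : nat) : bool :=
  [|| j <= c, crossed t Y A B c j | crossed t Y B A c j].

Lemma linked_refl : reflexive linked.
Proof. by move=> c; rewrite /linked leqnn. Qed.

Lemma linked_mono c c' d d' : c <= c' -> d' <= d -> linked c d -> linked c' d'.
Proof.
move=> lec led /or3P[ledc|xAB|xBA]; apply/or3P.
- by apply: Or31; lia.
- by apply: Or32; apply: crossed_mono xAB.
- by apply: Or33; apply: crossed_mono xBA.
Qed.

(* The cuts between c and c.+1 that are not linked separate blocks, and all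
   crossings inside a block have the same orientation. A block is named by one
   of its own positions, of the parity prescribed by its orientation; if that
   is not its first position, it has a second one. *)
Definition block_start (c : nat) : nat :=
  c + (crossed t Y A B c c.+1 && odd c || crossed t Y B A c c.+1 && ~~ odd c).

Fixpoint block (c : nat) : nat :=
  if c is c'.+1 then if linked c' c then block c' else block_start c
  else block_start 0.

Lemma odd_block_start c :
  (crossed t Y A B c c.+1 -> ~~ odd (block_start c)) /\
  (crossed t Y B A c c.+1 -> odd (block_start c)).
Proof.
rewrite /block_start oddD.
split=> x; rewrite x.
  by rewrite (negPf (crossed_opposite agreeA agreeB (leqnSn c) (leqnSn c) x)); case: odd.
by rewrite (negPf (crossed_opposite agreeB agreeA (leqnSn c) (leqnSn c) x)); case: odd.
Qed.

(** Consecutive cuts cannot be crossed in opposite orientations, so the parity fixed at the start of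
    a block persists. *)
Lemma odd_block c :
  (crossed t Y A B c c.+1 -> ~~ odd (block c)) /\
  (crossed t Y B A c c.+1 -> odd (block c)).
Proof.
elim: c => [|c [IHp IHn]] /=; first exact: odd_block_start.
case: ifP => [|_]; last exact: odd_block_start.
have leqn1S k : k <= k.+2 by rewrite leqW.
case/or3P=> [|xAB|xBA]; first by rewrite ltnn.
- split=> [_|]; first exact: IHp.
  by rewrite (negPf (crossed_opposite agreeA agreeB (leqnn c.+1) (leqn1S c) xAB)).
- split=> [|_]; last exact: IHn.
  by rewrite (negPf (crossed_opposite agreeB agreeA (leqnn c.+1) (leqn1S c) xBA)).
Qed.

Lemma block_start_bounds c : c <= block_start c <= c + linked c c.+1.
Proof.
rewrite /block_start /linked ltnn leq_addr leq_add2l /=.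
by case: crossed; case: crossed; case: odd.
Qed.

(** A name exceeds the position [c] only if [c.+1] is in the same block; this keeps names in order
    and below the number of positions. *)
Lemma block_le c : block c <= c + linked c c.+1.
Proof.
elim: c => [|c IHc]; first by case/andP: (block_start_bounds 0).
rewrite [block _]/=; case: ifP => [lk|_]; last by case/andP: (block_start_bounds c.+1).
by move: IHc; rewrite lk addn1 => /leq_trans; apply; apply: leq_addr.
Qed.

Lemma block_mono c d : c <= d -> block c <= block d.
Proof.
elim: d => [|d IHd]; first by rewrite leqn0 => /eqP->.
rewrite leq_eqVlt ltnS => /predU1P[->//|/IHd le] /=; apply: leq_trans le _.
case: ifP => // nlk; apply: leq_trans (block_le d) _.
by rewrite nlk addn0; have := block_start_bounds d.+1; lia.
Qed.

Lemma block_linked c d : c <= d -> linked c d -> block c = block d.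
Proof.
elim: d => [|d IHd]; first by rewrite leqn0 => /eqP->.
rewrite leq_eqVlt ltnS => /predU1P[->//|le] lk /=.
rewrite (linked_mono le (leqnn _) lk); apply: IHd => //.
exact: linked_mono lk.
Qed.

Lemma odd_block_crossed c d : c < d ->
  (crossed t Y A B c d -> ~~ odd (block c)) /\
  (crossed t Y B A c d -> odd (block c)).
Proof.
move=> ltcd; have [bAB bBA] := odd_block c.
by split=> x; [apply: bAB | apply: bBA]; apply: crossed_mono x.
Qed.

End Blocks.

(** * Keys for the upper side *)

(** The digits are block, shifted turn and offset; the middle radix is [n.+1] since [r + s] can
    reach [n]. *)
Definition closing_key (n b r p : nat) (s : bool) : nat := (b * n.+1 + (r + s)) * n + p.

Section ClosingKey.
Variables (n : nat) (V : finType) (t Y : V -> nat) (A B : {set V}) (e : bool).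
Variables (link : rel nat) (blk p : nat -> nat).
Hypotheses (agreeA : order_agree t Y A) (agreeB : order_agree t Y B).
Hypothesis linkE : forall c j, link c j = linked t Y A B c j.
Hypothesis blk_mono : forall c d, c <= d -> blk c <= blk d.
Hypothesis blk_linked : forall c d, c <= d -> link c d -> blk c = blk d.
Hypothesis blk_odd : forall c d, c < d ->
  (crossed t Y A B c d -> odd (blk c) = e) /\ (crossed t Y B A c d -> odd (blk c) = ~~ e).
Hypothesis p_lt : forall c, c < n -> p c < n.
Hypothesis p_inj : forall c d, c < n -> d < n -> p c = p d -> c = d.
Hypothesis p_offset : forall c d, c < n -> d < n -> turn link d = (turn link c).+1 ->
  link c d = (p d < p c).

Let key (c : nat) (s : bool) := closing_key n (blk c) (turn link c) (p c) s.

(** [A] is shifted in blocks of parity [e], [B] in the others. Exchanging the chains and negating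
    [e] covers pairs whose earlier point is in [B]. *)
Lemma closing_key_lt a b : a \in A -> b \in B -> t a < t b -> t b < n ->
  (Y b < Y a -> key (t b) (odd (blk (t b)) != e) < key (t a) (odd (blk (t a)) == e)) /\
  (Y a < Y b -> key (t a) (odd (blk (t a)) == e) < key (t b) (odd (blk (t b)) != e)).
Proof.
move=> aA bB ltab ltb; have lta := ltn_trans ltab ltb.
have refl : reflexive link by move=> c; rewrite linkE; apply: linked_refl.
have mono c c' d d' : c <= c' -> d' <= d -> link c d -> link c' d'.
  by rewrite !linkE; apply: linked_mono.
have rab := turn_mono link (ltnW ltab).
have rb : turn link (t b) <= t b by apply: turn_le.
have pa := p_lt lta; have pb := p_lt ltb.
have farl := @link_far_turn link mono (t a) (t b).
have samel := @link_same_turn link refl mono (t a) (t b).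
have offl := p_offset lta ltb.
have pab : p (t a) <> p (t b) by move=> /(p_inj lta ltb); lia.
have [oAB oBA] := blk_odd ltab.
rewrite /key /closing_key.
split=> [Yba|Yab].
  (* The pair is a crossing, so its block has parity [e] and only [a] is shifted. Being linked, [b]
     is at most one turn later; if exactly one, the offsets decide. *)
  have xAB : crossed t Y A B (t a) (t b) by apply/crossedP; exists a, b.
  have lk : link (t a) (t b) by rewrite linkE /linked xAB orbT.
  rewrite -(blk_linked (ltnW ltab) lk) oAB // eqxx /= addn0 addn1.
  have [lt|ge] := ltnP (turn link (t b)) (turn link (t a)).+1.
    by apply: lex_ltl => //; rewrite ltn_add2l.
  have [|ne] := eqVneq (turn link (t b)) (turn link (t a)).+1.
    by move=> eqr; rewrite eqr; apply: lex_ltr => //; rewrite -offl.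
  have far : (turn link (t a)).+1 < turn link (t b) by lia.
  by have := farl far; rewrite lk.
have := blk_mono (ltnW ltab); rewrite leq_eqVlt => /predU1P[eqb|ltb'].
  rewrite -eqb.
  have [oe|one] := eqVneq (odd (blk (t a))) e; last first.
    by apply: lex_ltl => //; rewrite ltn_add2l; lia.
  rewrite /= addn0 addn1.
  (* A crossing from [A] to [B] would reverse this pair, one from [B] to [A] has the wrong parity.
     So [b] is in a later turn, which makes up for the shift of [a]. *)
  have nlk : ~~ link (t a) (t b).
    rewrite linkE; apply/or3P=> -[le|xAB|xBA].
    - by rewrite leqNgt ltab in le.
    - by have := crossed_pair agreeA agreeB xAB erefl erefl aA bB; lia.
    - by have := oBA xBA; rewrite oe; case: e.
  have ne1 : turn link (t b) <> turn link (t a) by move=> /samel; rewrite (negPf nlk).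
  have [eqr|ne] := eqVneq (turn link (t b)) (turn link (t a)).+1.
    by rewrite eqr; apply: lex_ltr => //; have := offl eqr; rewrite (negPf nlk); lia.
  by apply: lex_ltl => //; rewrite ltn_add2l; lia.
apply: lex_ltl => //.
apply: (@leq_trans ((blk (t a)).+1 * n.+1)).
  by rewrite mulSn addnC ltn_add2r; have := leq_b1 (odd (blk (t a)) == e); lia.
by apply: leq_trans (leq_addr _ _); rewrite leq_mul2r ltb'.
Qed.

End ClosingKey.

Lemma closing_triples (n : nat) (V : finType) (t Y : V -> nat) (A B : {set V}) :
  (forall v, t v < n) -> injective t -> order_agree t Y A -> order_agree t Y B ->
  [disjoint A & B] ->
  exists b r p : nat -> nat,
    [/\ forall c, c < n -> [/\ b c < n, r c < n & p c < n],
        forall c d, c < d < n -> lex3 (b c) (r c) (p c) (b d) (r d) (p d) &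
        forall u v, u \in A -> v \in B ->
          let ku := closing_key n (b (t u)) (r (t u)) (p (t u)) (~~ odd (b (t u))) in
          let kv := closing_key n (b (t v)) (r (t v)) (p (t v)) (odd (b (t v))) in
          (Y u < Y v -> ku < kv) /\ (Y v < Y u -> kv < ku)].
Proof.
move=> ltt injt agA agB disAB; set lk := linked t Y A B.
have [p [ltp injp monop offp]] :=
  @semiorder_offset lk (@linked_mono _ t Y A B) n.
exists (block t Y A B), (turn lk), p; split=> [c ltc|c d /andP[ltcd ltd]|u v uA vB].
- split; [|by apply: leq_ltn_trans (turn_le lk c) ltc|exact: ltp].
  (* No point has position [n], so [n.-1] is not linked to [n] and its block name stays below
     [n]. *)
  have lec : c <= n.-1 by lia.
  apply: leq_ltn_trans (block_mono t Y A B lec) _.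
  apply: leq_ltn_trans (block_le t Y A B n.-1) _.
  rewrite prednK; last by lia.
  suff -> : linked t Y A B n.-1 n = false by lia.
  by apply/or3P=> -[|/crossedP|/crossedP]; [lia| |];
    case=> x [y [_ _ _]]; rewrite leqNgt ltt.
- rewrite /lex3; have := block_mono t Y A B (ltnW ltcd).
  rewrite leq_eqVlt => /predU1P[->|->//]; rewrite eqxx ltnn /=.
  have := turn_mono lk (ltnW ltcd); rewrite leq_eqVlt => /predU1P[eqr|->//].
  by rewrite eqr eqxx ltnn /= monop // ltcd.
- move=> ku kv.
  have uv : t u <> t v.
    by move=> /injt euv; have := disjointFr disAB uA; rewrite euv vB.
  have [ltuv|ltvu|//] := ltngtP (t u) (t v).
    have := @closing_key_lt n V t Y A B false lk (block t Y A B) p agA agB.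
    case/(_ _ _ _ _ ltp injp offp u v uA vB ltuv (ltt v)) => //.
    - exact: block_mono.
    - exact: block_linked.
    - move=> c d ltcd; have [h1 h2] := odd_block_crossed agA agB ltcd.
      by split=> [/h1/negbTE|/h2].
    - by rewrite !eqbF_neg negbK.
  have := @closing_key_lt n V t Y B A true lk (block t Y A B) p agB agA.
  case/(_ _ _ _ _ ltp injp offp v u vB uA ltvu (ltt u)) => //.
  - by move=> c j; rewrite /lk /linked [crossed _ _ A B _ _ || _]orbC.
  - exact: block_mono.
  - exact: block_linked.
  - move=> c d ltcd; have [h1 h2] := odd_block_crossed agA agB ltcd.
    by split=> [/h2|/h1/negbTE].
  - by rewrite !eqb_id.
Qed.

(** * Order and bounds of the keys *)

Definition linear_key (n b r p : nat) : nat := (b * n + r) * n + p.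

Lemma linear_key_lt n b r p b' r' p' : r < n -> p < n ->
  lex3 b r p b' r' p' -> linear_key n b r p < linear_key n b' r' p'.
Proof.
move=> ltr ltp /or3P[ltb|/andP[/eqP-> ltr']|/and3P[/eqP-> /eqP-> ltp']].
- by do 2!apply: lex_ltl => //.
- by apply: lex_ltl => //; rewrite ltn_add2l.
- exact: lex_ltr.
Qed.

(** Points of one chain in one block are shifted alike, and a shift never carries into the block
    digit. *)
Lemma closing_key_lex n b r p b' r' p' k : r < n -> p < n ->
  lex3 b r p b' r' p' ->
  closing_key n b r p (k == odd b) < closing_key n b' r' p' (k == odd b').
Proof.
move=> ltr ltp /or3P[ltb|/andP[/eqP-> ltr']|/and3P[/eqP-> /eqP-> ltp']].
- by do 2!apply: lex_ltl => //; lia.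
- by apply: lex_ltl => //; rewrite ltn_add2l ltn_add2r.
- exact: lex_ltr.
Qed.

Lemma linear_key_ub n b r p : b < n -> r < n -> p < n ->
  linear_key n b r p < n * n.+1 * n.
Proof.
move=> ltb ltr ltp; rewrite -[X in _ < X]addn0; apply: lex_ltl => //.
by rewrite mulnS addnC; have := lex_ltl 0 ltr ltb; lia.
Qed.

Lemma closing_key_ub n b r p s : b < n -> r < n -> p < n ->
  closing_key n b r p s < n * n.+1 * n.
Proof.
move=> ltb ltr ltp; rewrite -[X in _ < X]addn0; apply: lex_ltl => //.
by rewrite -[X in _ < X]addn0; apply: lex_ltl => //; have := leq_b1 s; lia.
Qed.

(** * Permutation graphs as inversion graphs of coordinates *)

Section Coordinates.
Variables (V : finType) (X Y : V -> nat).

Definition inversion (u v : V) : bool :=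
  (X u < X v) && (Y v < Y u) || (X v < X u) && (Y u < Y v).

End Coordinates.

Definition coord_rank (V : finType) (X : V -> nat) (v : V) : nat :=
  #|[set u | X u < X v]|.

Lemma coord_rank_ub (V : finType) (X : V -> nat) v : coord_rank X v < #|V|.
Proof.
rewrite -cardsT; apply: proper_card; apply/properP; split; first exact: subsetT.
by exists v; rewrite ?inE ?ltnn.
Qed.

Lemma ltn_coord_rank (V : finType) (X : V -> nat) u v :
  (coord_rank X u < coord_rank X v) = (X u < X v).
Proof.
have [lt|le] := ltnP (X u) (X v).
  apply: proper_card; apply/properP; split.
    by apply/subsetP=> w; rewrite !inE => /ltn_trans; apply.
  by exists u; rewrite !inE ?ltnn.
apply/negbTE; rewrite -leqNgt; apply: subset_leq_card.
by apply/subsetP=> w; rewrite !inE => /leq_trans; apply.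
Qed.

Lemma coord_rank_inj (V : finType) (X : V -> nat) : injective X -> injective (coord_rank X).
Proof.
move=> injX u v eq; apply: injX.
have := ltn_coord_rank X u v; have := ltn_coord_rank X v u.
by rewrite eq ltnn; case: ltngtP.
Qed.

Lemma inversion_permutation_graph (G : sgraph) (X Y : G -> nat) :
  injective X -> injective Y -> (forall u v : G, adj u v = inversion X Y u v) ->
  permutation_graph G.
Proof.
move=> injX injY adjE.
pose fX (v : G) := Ordinal (coord_rank_ub X v).
pose fY (v : G) := Ordinal (coord_rank_ub Y v).
have injfX : injective fX by move=> u v [] /coord_rank_inj; apply.
have injfY : injective fY by move=> u v [] /coord_rank_inj; apply.
have [|g fXK gK] := inj_card_bij injfX; first by rewrite card_ord.
have injs : injective (fY \o g) by apply: inj_comp injfY (can_inj gK).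
(* Labels are [X]-ranks and positions are [Y]-ranks; the map from label to position is [s^-1],
   whence the inverse. *)
exists #|G|, (perm injs)^-1%g; exists fX => [|u v]; first by exists g.
rewrite adjE /= /perm_adj /appears_before invgK !permE /= !fXK.
by rewrite !ltn_coord_rank.
Qed.

Lemma permutation_graph_inversion (G : sgraph) : permutation_graph G ->
  exists X Y : G -> nat,
    [/\ injective X, injective Y & forall u v : G, adj u v = inversion X Y u v].
Proof.
case=> m [s [f bijf adjf]]; have injf := bij_inj bijf.
exists (fun v => f v : nat), (fun v => (s^-1)%g (f v) : nat).
split=> [u v /ord_inj/injf //|u v /ord_inj/perm_inj/injf //|u v].
by rewrite -adjf.
Qed.

Lemma contains_induced_embedding (G H : sgraph) (e : H -> G) :
  injective e -> (forall u v : H, adj (e u) (e v) = adj u v) -> contains_induced G H.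
Proof.
move=> inje adje; exists [set e x | x in H].
pose f (x : H) : induced [set e x | x in H] := exist _ (e x) (imset_f e (erefl true : x \in H)).
exists f => // ; apply: inj_card_bij => [u v [] /inje //|].
by rewrite card_sig card_imset.
Qed.

(** * The universal graph *)

Section Universal.
Variable n : nat.

Definition universal_vertex : finType := (bool * bool * ('I_n * 'I_n * 'I_n))%type.

Implicit Types u v : universal_vertex.

Definition in_clique u := u.1.1.
Definition on_left u := u.1.2.

Definition arm_pos u :=
  let: (b, r, p) := u.2 in linear_key n b r p.
(** The parity of [b] decides which chain runs one turn ahead on the upper side. *)
Definition arm_pos_up u :=
  let: (b, r, p) := u.2 in closing_key n b r p (in_clique u == odd b).

(** Room for both kinds of key, doubled since a coordinate uses twice a key plus a bit separating
    clique from independent vertices. *)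
Definition half_width := (n * n.+1 * n).*2.

Definition abscissa u :=
  if on_left u then half_width - ((arm_pos u).*2 + in_clique u).+1
  else half_width + ((arm_pos u).*2 + in_clique u).

(** The descending clique is high on the left, the ascending independent set on the right: exactly
    there the two bits agree, and only there the shifted key is used. *)
Definition ordinate u :=
  if in_clique u == on_left u then half_width + ((arm_pos_up u).*2 + in_clique u)
  else half_width - ((arm_pos u).*2 + in_clique u).+1.

Definition lex_pos u v :=
  let: (b, r, p) := u.2 in let: (b', r', p') := v.2 in lex3 b r p b' r' p'.

Lemma lex_pos_total u v : u.2 != v.2 -> lex_pos u v || lex_pos v u.
Proof.
case: u v => [ku [[b r] p]] [kv [[b' r'] p']]; rewrite /lex_pos /lex3 /=.
by rewrite !xpair_eqE -!val_eqE /=; lia.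
Qed.

Lemma arm_pos_lt u v : lex_pos u v -> arm_pos u < arm_pos v.
Proof.
case: u v => [ku [[b r] p]] [kv [[b' r'] p']].
exact: linear_key_lt.
Qed.

Lemma arm_pos_up_lt u v : in_clique u = in_clique v ->
  lex_pos u v -> arm_pos_up u < arm_pos_up v.
Proof.
case: u v => [[ku lu] [[b r] p]] [[kv lv] [[b' r'] p']]; rewrite /in_clique /= => ->.
exact: closing_key_lex.
Qed.

Lemma arm_pos_ub u : arm_pos u < n * n.+1 * n.
Proof. by case: u => [ku [[b r] p]]; apply: linear_key_ub. Qed.

Lemma arm_pos_up_ub u : arm_pos_up u < n * n.+1 * n.
Proof. by case: u => [ku [[b r] p]]; apply: closing_key_ub. Qed.

Lemma arm_pos_inj u v : arm_pos u = arm_pos v -> u.2 = v.2.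
Proof.
move=> eq; apply/eqP; apply: contraT => /lex_pos_total /orP[] /arm_pos_lt;
  by rewrite eq ltnn.
Qed.

Lemma arm_pos_up_inj u v : in_clique u = in_clique v ->
  arm_pos_up u = arm_pos_up v -> u.2 = v.2.
Proof.
move=> eqk eq; apply/eqP; apply: contraT => /lex_pos_total /orP[].
  by move/(arm_pos_up_lt eqk); rewrite eq ltnn.
by move/(arm_pos_up_lt (esym eqk)); rewrite eq ltnn.
Qed.

Lemma abscissa_inj : injective abscissa.
Proof.
move=> u v; rewrite /abscissa /half_width => eq.
have ubu := arm_pos_ub u; have ubv := arm_pos_ub v.
have [eql eqk eqp] :
    [/\ on_left u = on_left v, in_clique u = in_clique v & arm_pos u = arm_pos v].
  by move: eq; case: (on_left u); case: (on_left v); case: (in_clique u);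
     case: (in_clique v); split=> //; lia.
move/arm_pos_inj: eqp; case: u v eql eqk {eq ubu ubv} => [[ku lu] pu] [[kv lv] pv].
by rewrite /on_left /in_clique /= => -> -> ->.
Qed.

Lemma ordinate_inj : injective ordinate.
Proof.
move=> u v; rewrite /ordinate /half_width => eq.
have ubu := arm_pos_ub u; have ubv := arm_pos_ub v.
have ubu' := arm_pos_up_ub u; have ubv' := arm_pos_up_ub v.
have [eql eqk eqp] :
    [/\ on_left u = on_left v, in_clique u = in_clique v & u.2 = v.2].
  have ip := @arm_pos_inj u v; have iq := @arm_pos_up_inj u v.
  move: eq ip iq; case: (on_left u); case: (on_left v); case: (in_clique u);
     case: (in_clique v) => /= eq ip iq; split=> //;
     first [by exfalso; lia | by apply: ip; lia | by apply: iq => //; lia].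
case: u v eql eqk eqp {eq ubu ubv ubu' ubv'} => [[ku lu] pu] [[kv lv] pv].
by rewrite /on_left /in_clique /= => -> -> ->.
Qed.

Lemma universal_adj_sym : symmetric (inversion abscissa ordinate).
Proof. by move=> u v; apply: orbC. Qed.

Lemma universal_adj_irr : irreflexive (inversion abscissa ordinate).
Proof. by move=> u; rewrite /inversion ltnn. Qed.

Definition universal_graph : sgraph := SGraph universal_adj_sym universal_adj_irr.

Lemma card_universal_graph : #|universal_graph| = 4 * n ^ 3.
Proof. by rewrite !card_prod card_bool !card_ord; lia. Qed.

Lemma lex_pos_inversion u v : lex_pos u v -> in_clique u = in_clique v ->
  inversion abscissa ordinate u v = in_clique u.
Proof.
move=> lexuv eqk; have ltp := arm_pos_lt lexuv; have ltq := arm_pos_up_lt eqk lexuv.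
have ubu := arm_pos_ub u; have ubv := arm_pos_ub v.
rewrite /inversion /abscissa /ordinate /half_width -eqk.
by case: (on_left u); case: (on_left v); case: (in_clique u) => /=; lia.
Qed.

Lemma split_universal_graph : split_graph universal_graph.
Proof.
have same u v : in_clique u = in_clique v -> u != v ->
    inversion abscissa ordinate u v = in_clique u.
  move=> eqk uv.
  have [eqp|/lex_pos_total/orP[]] := eqVneq u.2 v.2; last 2 first.
  - by move=> lexuv; apply: lex_pos_inversion.
  - by move=> lexvu; rewrite universal_adj_sym eqk; apply: lex_pos_inversion.
  have eql : on_left u = ~~ on_left v.
    move: uv eqk; rewrite /on_left /in_clique.
    case: u v eqp => [[ku lu] pu] [[kv lv] pv] /= -> + eqk.
    by rewrite eqk !xpair_eqE !eqxx andbT /=; case: lu; case: lv.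
  have ubu := arm_pos_ub u; have ubv := arm_pos_ub v.
  rewrite /inversion /abscissa /ordinate /half_width -eqk eql.
  by case: (on_left v); case: (in_clique u) => /=; lia.
exists [set u | in_clique u]; split=> u v; rewrite !inE => ku kv.
  by move=> uv; rewrite /= same // ku kv.
have [->|uv] := eqVneq u v; first by rewrite adj_irr.
by rewrite /= same // (negPf ku) (negPf kv).
Qed.

Lemma permutation_universal_graph : permutation_graph universal_graph.
Proof. exact: (@inversion_permutation_graph universal_graph _ _ abscissa_inj ordinate_inj). Qed.

End Universal.

(** * The center and the four arms of a split permutation graph *)

(* The cut cx is the least one to the right of which K lies below its
   complement. If K and its complement crossed the wrong way to the left of
   cx as well, they would do so around a point with abscissa cx.-1. *)
Lemma skew_merged_center (V : finType) (X Y : V -> nat) (K : {set V}) :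
  injective X ->
  {in K &, forall u v, (X u < X v) = (Y v < Y u)} ->
  {in ~: K &, forall u v, (X u < X v) = (Y u < Y v)} ->
  exists L : {set V},
    (forall u v, u \in L -> v \notin L -> X u < X v) /\
    (forall u v, (u \in K) != (u \in L) -> (v \in K) == (v \in L) -> Y u < Y v).
Proof.
move=> injX decK incI.
pose right c := [forall u in K, forall v in ~: K, (c <= X u) && (c <= X v) ==> (Y u < Y v)].
have rightP c : right c -> forall u v, u \in K -> v \notin K -> c <= X u -> c <= X v -> Y u < Y v.
  move=> /forall_inP h u v uK vK cu cv.
  have /forall_inP/(_ v) := h u uK; rewrite inE vK cu cv /=; exact.
have exr : exists c, right c.
  exists (\max_(v : V) X v).+1; apply/forall_inP=> u _; apply/forall_inP=> v _.
  by rewrite ltnNge leq_bigmax.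
case: (ex_minnP exr) => cx /rightP rcx mincx.
exists [set v | X v < cx]; split=> [u v|u v].
  by rewrite !inE -leqNgt => ltu lev; apply: leq_trans lev.
have left_cross i k : i \notin K -> k \in K -> X i < cx -> X k < cx -> Y i < Y k.
  move=> iK kK lti ltk; rewrite ltnNge; apply/negP=> leki.
  have : ~~ right cx.-1 by apply/negP=> /mincx; lia.
  case/forall_inPn=> k' k'K /forall_inPn[i']; rewrite inE => i'K.
  rewrite negb_imply -leqNgt => /andP[/andP[lek' lei'] le].
  have iI : i \in ~: K by rewrite inE.
  have i'I : i' \in ~: K by rewrite inE.
  have ne : i' != k' by apply: contraNneq i'K => ->.
  have neX : X i' <> X k' by move/injX/eqP; rewrite (negPf ne).
  (* The chains give [Y k' <= Y k <= Y i <= Y i' <= Y k'], and equality would put the distinct [i']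
     and [k'] both at abscissa [cx.-1]. *)
  have Xi : (X i' < X i) = (Y i' < Y i) by rewrite incI.
  have Xi' : (X i < X i') = (Y i < Y i') by rewrite incI.
  have Xk : (X k' < X k) = (Y k < Y k') by rewrite decK.
  have Xk' : (X k < X k') = (Y k' < Y k) by rewrite decK.
  have [far|near] := leqP cx (X i'); last by lia.
  have [far'|near'] := leqP cx (X k'); last by lia.
  by have := rcx _ _ k'K i'K far' far; lia.
rewrite !inE; have [uK|uK] := boolP (u \in K); have [vK|vK] := boolP (v \in K);
  rewrite ?eqbF_neg ?eqb_id /= => ul vl.
- by rewrite -decK //; lia.
- by apply: rcx => //; lia.
- by apply: left_cross => //; lia.
- by rewrite -incI ?inE //; lia.
Qed.

(* Positions along the path of arms K left, I left, K right, I right: they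
   increase outwards on the left, lower and right sides, and only the upper
   side, between the last arm and the first, may disagree with them. *)
Lemma outward_positions (V : finType) (X Y : V -> nat) (K L : {set V}) :
  {in K &, forall u v, (X u < X v) = (Y v < Y u)} ->
  {in ~: K &, forall u v, (X u < X v) = (Y u < Y v)} ->
  exists t : V -> nat,
    [/\ injective t, forall v, t v < #|V|,
        {in L &, forall u v, X v < X u -> t u < t v},
        {in ~: L &, forall u v, X u < X v -> t u < t v} &
        forall u v, (u \in K) != (u \in L) -> (v \in K) != (v \in L) ->
          Y v < Y u -> t u < t v].
Proof.
move=> decK incI.
pose lower v := (v \in K) != (v \in L).
pose R u v := [|| [&& u \in L, v \in L & X v < X u],
                 [&& u \notin L, v \notin L & X u < X v] |
                 [&& lower u, lower v & Y v < Y u]].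
have decK' u v : u \in K -> v \in K -> (X u < X v) = (Y v < Y u) by apply: decK.
have incI' u v : u \notin K -> v \notin K -> (X u < X v) = (Y u < Y v).
  by move=> uK vK; apply: incI; rewrite inE.
(* Points of one arm may share two of the three sides; the chain condition then makes both demands
   the same. *)
have Rleft u v : u \in L -> v \in L -> R u v = (X v < X u).
  move=> uL vL; rewrite /R /lower uL vL /= !eqb_id.
  have [uK|uK] := boolP (u \in K); have [vK|vK] := boolP (v \in K); rewrite ?orbF //=.
  by rewrite incI' // orbb.
have Rright u v : u \notin L -> v \notin L -> R u v = (X u < X v).
  move=> uL vL; rewrite /R /lower (negPf uL) (negPf vL) /= !eqbF_neg !negbK.
  have [uK|uK] := boolP (u \in K); have [vK|vK] := boolP (v \in K); rewrite ?orbF //=.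
  by rewrite decK' // orbb.
have Rlower u v : lower u -> lower v -> R u v = (Y v < Y u).
  move=> lu lv; rewrite /R lu lv /=; move: lu lv; rewrite /lower.
  have [uL|uL] := boolP (u \in L); have [vL|vL] := boolP (v \in L);
    rewrite /= ?eqb_id ?eqbF_neg ?negbK // => uK vK.
    by rewrite incI' // orbb.
  by rewrite decK' // orbb.
(* Levels number the arms along the path. Points on two consecutive levels lie on a common side,
   where [R] is the comparison of one coordinate. *)
pose lev v : nat := if v \in L then if v \in K then 0 else 1 else if v \in K then 2 else 3.
have [|t [injt ltt monot]] := @linear_extension _ R.
  apply: (@level_minimal _ lev).
  - by move=> u; rewrite /R !ltnn !andbF.
  - move=> u v; rewrite /R /lev /lower.
    by case: (u \in L); case: (v \in L); case: (u \in K); case: (v \in K).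
  - move=> a u v w lu lv lw.
    have : [|| [&& u \in L, v \in L & w \in L], [&& u \notin L, v \notin L & w \notin L]
             | [&& lower u, lower v & lower w]].
      move: lu lv lw; rewrite /lev /lower.
      by case: (u \in L); case: (v \in L); case: (w \in L);
         case: (u \in K); case: (v \in K); case: (w \in K); case: a => [|[|[|[|a]]]].
    case/or3P=> /and3P[cu cv cw].
    + by rewrite !Rleft // => lt1 lt2; apply: ltn_trans lt2 lt1.
    + by rewrite !Rright //; apply: ltn_trans.
    + by rewrite !Rlower // => lt1 lt2; apply: ltn_trans lt2 lt1.
exists t; split=> // u v.
- by move=> uL vL lt; apply: monot; rewrite Rleft.
- by rewrite !inE => uL vL lt; apply: monot; rewrite Rright.
- by move=> lu lv lt; apply: monot; rewrite Rlower.
Qed.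

(** * The embedding and the theorem *)

Lemma universal_embedding (V : finType) (X Y : V -> nat) (K : {set V}) :
  injective X -> injective Y ->
  {in K &, forall u v, (X u < X v) = (Y v < Y u)} ->
  {in ~: K &, forall u v, (X u < X v) = (Y u < Y v)} ->
  exists e : V -> universal_vertex #|V|,
    (forall u v, X u < X v -> abscissa (e u) < abscissa (e v)) /\
    (forall u v, Y u < Y v -> ordinate (e u) < ordinate (e v)).
Proof.
move=> injX injY decK incI.
have [L [sepX sepY]] := skew_merged_center injX decK incI.
have [t [injt ltt tleft tright tlower]] := outward_positions L decK incI.
have agree (A : {set V}) : {in A &, forall u v, Y u < Y v -> t u < t v} -> order_agree t Y A.
  move=> mono u v uA vA; have := mono u v uA vA; have := mono v u vA uA.
  case: (ltngtP (Y u) (Y v)) => [||/injY->]; rewrite ?leqnn //.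
  - by move=> _ _ /(_ isT)/ltnW.
  - by move=> _ /(_ isT); rewrite ltnNge => /negPf.
(* The two upper arms: outward means upward on both. *)
have agA : order_agree t Y (~: K :\: L).
  apply: agree => u v; rewrite !inE => /andP[uL uK] /andP[vL vK] lt.
  by apply: tright; rewrite ?inE // incI ?inE.
have agB : order_agree t Y (K :&: L).
  apply: agree => u v; rewrite !inE => /andP[uK uL] /andP[vK vL] lt.
  by apply: tleft; rewrite // decK.
have [|b [r [p [bound lexmono closing]]]] := closing_triples ltt injt agA agB.
  by rewrite -setI_eq0; apply/eqP/setP=> v; rewrite !inE; case: (v \in K); rewrite ?andbF.
have ltb v : b (t v) < #|V| by case: (bound _ (ltt v)).
have ltr v : r (t v) < #|V| by case: (bound _ (ltt v)).
have ltp v : p (t v) < #|V| by case: (bound _ (ltt v)).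
pose e v : universal_vertex #|V| :=
  (v \in K, v \in L, (Ordinal (ltb v), Ordinal (ltr v), Ordinal (ltp v))).
have lexe u v : t u < t v -> lex_pos (e u) (e v).
  by move=> lt; apply: lexmono; rewrite lt ltt.
have leftE v : on_left (e v) = (v \in L) by [].
have cliqueE v : in_clique (e v) = (v \in K) by [].
exists e; split=> u v lt; rewrite /abscissa /ordinate /half_width !leftE !cliqueE;
  have ubu := arm_pos_ub (e u); have ubv := arm_pos_ub (e v).
- have posm := @arm_pos_lt _ (e u) (e v); have posm' := @arm_pos_lt _ (e v) (e u).
  have [uL|uL] := boolP (u \in L); have [vL|vL] := boolP (v \in L).
  + by have /lexe/posm' : t v < t u by [apply: tleft]; lia.
  + by lia.
  + by have := sepX _ _ vL uL; lia.
  + have /lexe/posm : t u < t v by apply: tright; rewrite ?inE.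
    by lia.
- have upm := @arm_pos_up_lt _ (e u) (e v); have posm' := @arm_pos_lt _ (e v) (e u).
  have [uu|ud] := boolP ((u \in K) == (u \in L)); last first.
    have [vu|vd] := boolP ((v \in K) == (v \in L)); first by lia.
    by have /lexe/posm' : t v < t u by [apply: tlower]; lia.
  have [vu|vd] := boolP ((v \in K) == (v \in L)); last first.
    by have := sepY _ _ vd uu; lia.
  (* Both points are on the upper side: on a common arm the order of the triples decides, on
     different arms the last clause of [closing_triples]. *)
  suff : arm_pos_up (e u) < arm_pos_up (e v) by lia.
  have posE w : arm_pos_up (e w) =
      closing_key #|V| (b (t w)) (r (t w)) (p (t w)) ((w \in K) == odd (b (t w))) by [].
  move/eqP: uu => uu; move/eqP: vu => vu.
  have [uK|uK] := boolP (u \in K); have [vK|vK] := boolP (v \in K).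
  + apply: upm; first by rewrite !cliqueE uK vK.
    by apply: lexe; apply: tleft; rewrite -?uu -?vu // decK.
  + have vA : v \in ~: K :\: L by rewrite !inE -vu vK.
    have uB : u \in K :&: L by rewrite inE -uu uK.
    case: (closing v u vA uB) => _ /(_ lt).
    by rewrite !posE uK (negPf vK) !(eq_sym _ (odd _)) eqbF_neg eqb_id.
  + have uA : u \in ~: K :\: L by rewrite !inE -uu uK.
    have vB : v \in K :&: L by rewrite inE -vu vK.
    case: (closing u v uA vB) => /(_ lt) + _.
    by rewrite !posE vK (negPf uK) !(eq_sym _ (odd _)) eqbF_neg eqb_id.
  + apply: upm; first by rewrite !cliqueE (negPf uK) (negPf vK).
    by apply: lexe; apply: tright; rewrite ?inE -?uu -?vu // incI ?inE.
Qed.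

Lemma split_permutation_graph_coordinates (H : sgraph) : split_permutation_graph H ->
  exists (X Y : H -> nat) (K : {set H}),
    [/\ injective X, injective Y, forall u v : H, adj u v = inversion X Y u v,
        {in K &, forall u v, (X u < X v) = (Y v < Y u)} &
        {in ~: K &, forall u v, (X u < X v) = (Y u < Y v)}].
Proof.
case=> -[K [cliqueK indI]] /permutation_graph_inversion[X [Y [injX injY adjE]]].
exists X, Y, K; split=> // u v uS vS; have [->|uv] := eqVneq u v; rewrite ?ltnn //.
all: have neX : X u <> X v by move/injX/eqP; rewrite (negPf uv).
all: have neY : Y u <> Y v by move/injY/eqP; rewrite (negPf uv).
- by have := cliqueK u v uS vS uv; rewrite adjE /inversion; lia.
- by have := indI u v uS vS; rewrite adjE /inversion; lia.
Qed.

Theorem theorem4p3 (n : nat) (hn : 1 <= n) :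
  exists G : sgraph,
    [/\ split_permutation_graph G,
        #|G| = 4 * n ^ 3 &
        forall H : sgraph, split_permutation_graph H -> #|H| = n ->
          contains_induced G H].
Proof.
exists (universal_graph n); split.
- by split; [exact: split_universal_graph | exact: permutation_universal_graph].
- exact: card_universal_graph.
move=> H /split_permutation_graph_coordinates[X [Y [K [injX injY adjE decK incI]]]] <-.
have [e [monoX monoY]] := universal_embedding injX injY decK incI.
have eX u v : (abscissa (e u) < abscissa (e v)) = (X u < X v).
  case: (ltngtP (X u) (X v)) => [/monoX->//|/monoX/ltnW|/injX->]; last by rewrite ltnn.
  by rewrite leqNgt => /negbTE.
have eY u v : (ordinate (e u) < ordinate (e v)) = (Y u < Y v).
  case: (ltngtP (Y u) (Y v)) => [/monoY->//|/monoY/ltnW|/injY->]; last by rewrite ltnn.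
  by rewrite leqNgt => /negbTE.
apply: (@contains_induced_embedding (universal_graph #|H|) H e) => [u v eq|u v].
  by apply: injX; have := eX u v; have := eX v u; rewrite eq ltnn; case: ltngtP.
by rewrite adjE /= /inversion !eX !eY.
Qed.
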